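(* Let $G$ be a connected finite simple $d$-regular graph, $d\ge 2$, with $n$ vertices and $m$ edges, and let ${\bf P}$ be the transition probability matrix of the correlated random walk on $G$ with respect to the Grover matrix. Then, counting eigenvalues with multiplicity, ${\bf P}$ has $2n$ eigenvalues of the form $$\lambda=\frac{2\lambda_A\pm\sqrt{4\lambda_A^2-d^3(4-d)}}{d^2},$$ where $\lambda_A$ runs over the eigenvalues (with multiplicity) of the adjacency matrix ${\bf A}(G)$. The remaining $2(m-n)$ eigenvalues of ${\bf P}$ are $\pm(4-d)/d$ with equal multiplicities $m-n$.
   Context: For a finite simple graph $G$, $D(G)=\{(u,v),(v,u)\mid uv\in E(G)\}$ is its set of arcs. For $e=(u,v)\in D(G)$, write $o(e)=u$, $t(e)=v$, $e^{-1}=(v,u)$. The degree of $v$ is $d_v=\deg v$; $G$ is $d$-regular if every vertex has degree $d$. With $m$ edges, $|D(G)|=2m$. The Grover matrix of $G$ is the $2m\times 2m$ matrix ${\bf U}=(U_{ef})_{e,f\in D(G)}$ with $U_{ef}=2/d_{t(f)}$ if $t(f)=o(e)$ and $f\ne e^{-1}$; $U_{ef}=2/d_{t(f)}-1$ if $f=e^{-1}$; and $U_{ef}=0$ otherwise. The transition probability matrix of the correlated random walk on $G$ with respect to the Grover matrix is ${\bf P}=(P_{ef})_{e,f\in D(G)}$ with $P_{ef}=|U_{ef}|^2$. Square roots are complex square roots (both signs are taken). *)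

(* Defs.v *)
From HB Require Import structures.
From mathcomp Require Import all_boot all_order all_algebra.

Set Implicit Arguments.
Unset Strict Implicit.
Unset Printing Implicit Defensive.

Import Order.TTheory GRing.Theory Num.Theory.
Local Open Scope ring_scope.

(* A finite simple graph is a symmetric irreflexive relation
   [e] on the finite type [T] of its vertices. *)

Section Graph.
Variables (T : finType) (e : rel T).

Definition edges : {set {set T}} :=
  [set [set p.1; p.2] | p in [pred p : T * T | e p.1 p.2]].

Definition deg (v : T) : nat := #|[set w | e v w]|.

Definition regular (d : nat) : Prop := forall v, deg v = d.

(* [connect e] is the reflexive transitive closure of [e]. *)
Definition connected_graph : Prop :=
  (0 < #|T|)%N /\ forall u v, connect e u v.

Definition arc : finType := {p : T * T | e p.1 p.2}.

Definition org (a : arc) : T := (val a).1.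
Definition ter (a : arc) : T := (val a).2.

(* [is_inv a b] says that b is a with its orientation reversed; stated on the
   underlying pairs, it does not need the symmetry of [e]. *)
Definition is_inv (a b : arc) : bool := val b == (ter a, org a).

End Graph.

(* Matrices indexed by vertices or arcs are numbered by [enum_val].  The
   complex numbers are an arbitrary numClosedFieldType, so that both R[i], for
   R the real numbers, and algC are covered. *)
Section Matrices.
Variables (C : numClosedFieldType) (T : finType) (e : rel T).

Definition adjacency_mx : 'M[C]_#|T| :=
  \matrix_(i, j) (e (enum_val i) (enum_val j))%:R.

Definition grover_entry (a b : arc e) : C :=
  if is_inv a b then 2%:R / (deg e (ter b))%:R - 1
  else if ter b == org a then 2%:R / (deg e (ter b))%:R
  else 0.

Definition grover_mx : 'M[C]_#|arc e| :=
  \matrix_(i, j) grover_entry (enum_val i) (enum_val j).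

Definition transition_mx : 'M[C]_#|arc e| :=
  \matrix_(i, j) `|grover_mx i j| ^+ 2.

End Matrices.

(* The eigenvalues of a square matrix, repeated according to their algebraic
   multiplicity: the (monic) characteristic polynomial is the product of the
   'X - z%:P for z in this list.  The order of the list is unspecified. *)
Definition eigenvalues (C : numClosedFieldType) (n : nat) (M : 'M[C]_n)
  : seq C := sval (closed_field_poly_normal (char_poly M)).

(* Main.v *)
Require Import Defs.
From mathcomp Require Import all_boot all_order all_algebra ring.
Import Order.TTheory GRing.Theory Num.Theory.
Local Open Scope ring_scope.

Set Implicit Arguments.
Unset Strict Implicit.

(* The name [arc] also denotes an operation of [path] on cyclic sequences. *)
Local Notation arc := Defs.arc.

(** On a d-regular graph the transition matrix P is a low-rank perturbation of
    a multiple of an involution.  Let K be the arc-vertex incidence matrix of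
    origins, L the vertex-arc incidence matrix of termini and J the permutation
    matrix of arc reversal.  An entry of P is 4/d^2 when the two arcs are
    consecutive and not inverse to each other, and (2/d - 1)^2 =
    4/d^2 + (d - 4)/d when they are inverse, so ([transition_mxE])

      P = a K L + b J   with   a = 4/d^2  and  b = (d - 4)/d.

    Since J^2 = 1, the matrix X - b J has the polynomial quasi-inverse X + b J:
    their product is the scalar q = X^2 - b^2.  A block elimination that needs
    no division ([det_sub_mulmx]) then trades the determinant over arcs for one
    over vertices:

      det (X - P) q^n = det (X - b J) det (q - a L (X + b J) K).

    On the right, L K is the adjacency matrix A ([head_tail_mx]) and L J K is
    the diagonal matrix of degrees, here d ([flip_tail_mx],
    [head_trmx_head_mx]).  Reversal has no fixed arc, so that the eigenvalues
    1 and -1 of J have the same multiplicity m, and det (X - b J) = q^m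
    ([char_poly_involution]).  As n <= m, cancelling q^n gives

      det (X - P) = q^(m - n) det ((q - a b d) - a X A),

    and b^2 + a b d = b.  By triangularization of A
    ([det_scalar_sub_scale]), the last determinant is the product over the
    eigenvalues l of A of X^2 - a l X - b, whose roots are the two numbers of
    the statement ([prod_XsubC_quadratic]); the factor q^(m - n) contributes
    b and -b, each m - n times. *)

(** * Determinants and eigenvalues *)

(** This is det (N - K L) = det N det (1 - L N^-1 K) with N^-1 replaced by
    N'/q and denominators cleared, so that it also holds where N is not
    invertible.  Both sides are the determinant of the block matrix
    (N, K; L, 1) times q^n, computed by eliminating one or the other of its
    off-diagonal blocks. *)
Lemma det_sub_mulmx (R : comPzRingType) (p n : nat) (q : R) (N N' : 'M[R]_p)
    (K : 'M[R]_(p, n)) (L : 'M[R]_(n, p)) :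
  N *m N' = q%:M ->
  \det (N - K *m L) * q ^+ n = \det N * \det (q%:M - L *m N' *m K).
Proof.
move=> NN'.
have factor_left : block_mx N K L 1%:M
    = block_mx 1%:M K 0 1%:M *m block_mx (N - K *m L) 0 L 1%:M.
  by rewrite mulmx_block !(mul1mx, mul0mx, mulmx1, mulmx0, addr0, add0r) subrK.
have factor_right : block_mx N K L 1%:M *m block_mx 1%:M (- (N' *m K)) 0 q%:M
    = block_mx N 0 L (q%:M - L *m N' *m K).
  rewrite mulmx_block !(mulmx1, mul1mx, mulmx0, addr0, mulmxN) !mulmxA NN'.
  by rewrite mul_scalar_mx mul_mx_scalar addNr [- _ + _]addrC.
move/(congr1 determinant): factor_right.
rewrite det_mulmx factor_left det_mulmx !det_ublock !det_lblock.
by rewrite !det1 det_scalar !mul1r !mulr1.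
Qed.

(** The characteristic polynomial of A in homogeneous form.  The entries u and
    v are polynomials, because v will be a multiple of the variable: A is
    triangularized over the constants, and the triangular form is kept by the
    pencil u - v A, whose diagonal is then explicit. *)
Lemma det_scalar_sub_scale (C : numClosedFieldType) (n : nat) (A : 'M[C]_n)
    (s : seq C) (u v : {poly C}) :
  char_poly A = \prod_(l <- s) ('X - l%:P) ->
  \det (u%:M - v *: map_mx polyC A) = \prod_(l <- s) (u - v * l%:P).
Proof.
case: n A => [|n] A charA.
  have s_nil : size s = 0%N.
    by apply/eqP; rewrite -eqSS -(size_prod_XsubC s id) -charA size_char_poly.
  by rewrite (size0nil s_nil) big_nil det_mx00.
have [//|P /unitarymx_unit unitP trigP] := Schur A.
set B := conjmx P A in trigP; have {}trigP : is_trig_mx B := trigP.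
pose Q := map_mx polyC P; pose Q' := map_mx polyC (invmx P).
have QQ' : Q *m Q' = 1%:M by rewrite -map_mxM mulmxV // map_mx1.
have det_diag (x y : {poly C}) :
    \det (x%:M - y *: map_mx polyC A) = \prod_i (x - y * (B i i)%:P).
  have -> : \det (x%:M - y *: map_mx polyC A) = \det (x%:M - y *: map_mx polyC B).
    have -> : x%:M - y *: map_mx polyC B
        = Q *m (x%:M - y *: map_mx polyC A) *m Q'.
      rewrite /B conjumx // !map_mxM mulmxBr mulmxBl; congr (_ - _).
        by rewrite mul_mx_scalar -scalemxAl QQ' scalemx1.
      by rewrite -scalemxAr -scalemxAl.
    by rewrite !det_mulmx mulrAC -det_mulmx QQ' det1 mul1r.
  have entry i j : (x%:M - y *: map_mx polyC B) i j = x *+ (i == j) - y * (B i j)%:P.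
    by rewrite 5!mxE.
  rewrite det_trig; first by apply: eq_bigr => i _; rewrite entry eqxx.
  apply/is_trig_mxP => i j lt_ij.
  rewrite entry (is_trig_mxP trigP) // mulr0 subr0.
  by case: eqP lt_ij => [->|]; rewrite ?ltnn.
(* The pencil 'X - 1 A identifies s with the diagonal of B, up to order. *)
have perm_s : perm_eq s [seq B i i | i <- enum 'I_n.+1].
  apply: prod_XsubC_eq; rewrite -charA big_map big_enum /=.
  rewrite /char_poly /char_poly_mx -[map_mx _ _]scale1r det_diag.
  by apply: eq_bigr => i _; rewrite mul1r.
by rewrite det_diag (perm_big _ perm_s) big_map big_enum.
Qed.

Lemma eigenvaluesP (C : numClosedFieldType) (n : nat) (M : 'M[C]_n) :
  char_poly M = \prod_(z <- eigenvalues M) ('X - z%:P).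
Proof.
rewrite /eigenvalues; case: closed_field_poly_normal => s /= {1}->.
by rewrite (monicP (char_poly_monic M)) scale1r.
Qed.

Lemma size_eigenvalues (C : numClosedFieldType) (n : nat) (M : 'M[C]_n) :
  size (eigenvalues M) = n.
Proof.
apply/eqP; rewrite -eqSS -(size_prod_XsubC _ id) -eigenvaluesP.
by rewrite size_char_poly.
Qed.

Lemma mul_char_poly_mx_involution (R : comNzRingType) (p : nat) (b : R) (J : 'M[R]_p) :
  J *m J = 1%:M ->
  ('X%:M - map_mx polyC (b *: J)) *m ('X%:M + map_mx polyC (b *: J))
    = ('X^2 - (b ^+ 2)%:P)%:M.
Proof.
move=> JJ; rewrite !map_mxZ /=; set Jp := map_mx polyC J.
rewrite mulmxBl !mulmxDr -!scalar_mxM -!scalemxAl -!scalemxAr.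
rewrite mul_scalar_mx mul_mx_scalar -map_mxM JJ map_mx1 opprD addrA addrK.
by rewrite scalerA scalemx1 -raddfB -polyCM -!expr2.
Qed.

(** The matrix D, which anticommutes with J, conjugates X - b J into X + b J, so
    that these have the same determinant; its square is the determinant of
    the scalar matrix X^2 - b^2 of size 2m.  Taking the square root leaves
    a sign, which monicity fixes.  This covers b = 0, where counting the
    eigenvalues of b J would say nothing about J. *)
Lemma char_poly_involution (C : numFieldType) (m p : nat) (b : C)
    (J D : 'M[C]_p) :
  p = (2 * m)%N -> J *m J = 1%:M -> D *m D = 1%:M -> D *m J *m D = - J ->
  char_poly (b *: J) = ('X^2 - (b ^+ 2)%:P) ^+ m.
Proof.
move=> p2m JJ DD DJD.
have NN' := mul_char_poly_mx_involution b JJ.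
rewrite /char_poly /char_poly_mx; set N := _ - _ in NN' *; set N' := _ + _ in NN'.
pose Dp := map_mx polyC D.
have detN' : \det N' = \det N.
  have -> : N' = Dp *m N *m Dp.
    rewrite mulmxBr mulmxBl mul_mx_scalar -scalemxAl -!map_mxM DD map_mx1.
    by rewrite scalemx1 -scalemxAr -scalemxAl DJD scalerN map_mxN opprK.
  by rewrite !det_mulmx mulrAC -det_mulmx -map_mxM DD map_mx1 det1 mul1r.
have : \det N ^+ 2 == (('X^2 - (b ^+ 2)%:P) ^+ m) ^+ 2.
  by rewrite expr2 -{2}detN' -det_mulmx NN' det_scalar p2m mulnC exprM.
rewrite eqf_sqr => /orP[/eqP //|/eqP opp].
have := monicP (char_poly_monic (b *: J)).
rewrite /char_poly /char_poly_mx -/N opp lead_coefN.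
have /monicP-> : ('X^2 - (b ^+ 2)%:P) ^+ m \is monic.
  by apply: monic_exp; apply: monicXnsubC.
by move=> /eqP; rewrite eqr_oppLR -subr_eq0 opprK -mulr2n pnatr_eq0.
Qed.

Lemma mul_XsubC (R : comNzRingType) (x y : R) :
  ('X - x%:P) * ('X - y%:P) = 'X^2 - (x + y)%:P * 'X + (x * y)%:P.
Proof. by rewrite polyCD polyCM; ring. Qed.

(** The roots have sum a l and product -b, where 4 l^2 minus the radicand is
    d^3 (4 - d) = - b d^4. *)
Lemma prod_XsubC_quadratic (C : numClosedFieldType) (d : nat) (l : C) :
  (0 < d)%N ->
  \prod_(s <- [:: 1; -1])
    ('X - ((2%:R * l + s * sqrtC (4%:R * l ^+ 2 - d%:R ^+ 3 * (4%:R - d%:R)))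
           / d%:R ^+ 2)%:P)
  = 'X^2 - ((4%:R / d%:R ^+ 2) * l)%:P * 'X - ((d%:R - 4%:R) / d%:R)%:P.
Proof.
move=> d_gt0; have d_neq0 : d%:R != 0 :> C by rewrite pnatr_eq0 -lt0n.
rewrite !big_cons big_nil mulr1.
set D := 4%:R * _ - _; have := sqrtCK D.
move: (sqrtC D) => r r2.
set x := (_ + 1 * r) / _; set y := (_ + -1 * r) / _.
have sum_xy : x + y = 4%:R / d%:R ^+ 2 * l by rewrite /x /y; field.
have mul_xy : x * y = - ((d%:R - 4%:R) / d%:R).
  have -> : x * y = (4%:R * l ^+ 2 - r ^+ 2) / d%:R ^+ 4 by rewrite /x /y; field.
  by rewrite r2 /D; field.
by rewrite mul_XsubC sum_xy mul_xy polyCN.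
Qed.

(** * Arcs and incidence matrices *)

Lemma sum_enum_val (R : nmodType) (I : finType) (F : I -> R) :
  \sum_(k < #|I|) F (enum_val k) = \sum_x F x.
Proof. by rewrite -(big_enum_val F); apply: eq_bigl. Qed.

Lemma sum_delta (R : pzSemiRingType) (I : finType) (x : I) (F : I -> R) :
  \sum_y (y == x)%:R * F y = F x.
Proof.
rewrite (bigD1 x) //= eqxx mul1r big1 ?addr0 // => y /negbTE->.
by rewrite mul0r.
Qed.

Section Arcs.
Variables (C : numClosedFieldType) (T : finType) (e : rel T).
Hypothesis e_sym : symmetric e.
Hypothesis e_irr : irreflexive e.

Lemma sum_arc (F : T * T -> C) :
  \sum_(a : arc e) F (val a) = \sum_u \sum_v (e u v)%:R * F (u, v).
Proof.
rewrite -(@big_sub _ _ _ _ [pred p : T * T | e p.1 p.2] F) pair_big big_mkcond /=.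
by apply: eq_bigr => -[u v] _; rewrite inE /=; case: (e u v); rewrite ?mul1r ?mul0r.
Qed.

Lemma sum_deg (v : T) : \sum_x (e v x)%:R = (deg e v)%:R :> C.
Proof.
rewrite /deg -sum1_card natr_sum [RHS]big_mkcond; apply: eq_bigr => x _.
by rewrite inE; case: (e v x).
Qed.

Definition tail_mx : 'M[C]_(#|arc e|, #|T|) :=
  \matrix_(i, j) (org (enum_val i) == enum_val j)%:R.

Definition head_mx : 'M[C]_(#|T|, #|arc e|) :=
  \matrix_(i, j) (ter (enum_val j) == enum_val i)%:R.

Definition flip_mx : 'M[C]_#|arc e| :=
  \matrix_(i, j) (is_inv (enum_val i) (enum_val j))%:R.

(** An orientation of the graph as a sign on arcs: an arc is positive when its
    vertices come in decreasing order of rank, so that reversal changes the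
    sign. *)
Definition orientation (a : arc e) : C :=
  (-1) ^+ (enum_rank (org a) < enum_rank (ter a))%N.

Definition orientation_mx : 'M[C]_#|arc e| :=
  diag_mx (\row_i orientation (enum_val i)).

Lemma arc_inv_subproof (a : arc e) : e (ter a, org a).1 (ter a, org a).2.
Proof. by rewrite /= e_sym; exact: (valP a). Qed.

Definition arc_inv (a : arc e) : arc e := Sub (ter a, org a) (arc_inv_subproof a).

Lemma is_invE (a b : arc e) : is_inv a b = (b == arc_inv a).
Proof. by rewrite /is_inv -val_eqE SubK. Qed.

Lemma org_arc_inv (a : arc e) : org (arc_inv a) = ter a.
Proof. by []. Qed.

Lemma ter_arc_inv (a : arc e) : ter (arc_inv a) = org a.
Proof. by []. Qed.

Lemma arc_invK : involutive arc_inv.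
Proof.
move=> a; apply/eqP; rewrite eq_sym -is_invE /is_inv org_arc_inv ter_arc_inv.
by rewrite -surjective_pairing.
Qed.

Lemma mul_flip_mx (n : nat) (M : 'M[C]_(#|arc e|, n)) i j :
  (flip_mx *m M) i j = M (enum_rank (arc_inv (enum_val i))) j.
Proof.
rewrite mxE -(sum_delta (arc_inv (enum_val i)) (fun a => M (enum_rank a) j)).
rewrite -[RHS]sum_enum_val; apply: eq_bigr => k _.
by rewrite mxE is_invE enum_valK.
Qed.

Lemma flip_mx_involution : flip_mx *m flip_mx = 1%:M.
Proof.
apply/matrixP => i j; rewrite mul_flip_mx !mxE enum_rankK is_invE arc_invK.
by rewrite (inj_eq enum_val_inj) eq_sym.
Qed.

Lemma flip_tail_mx : flip_mx *m tail_mx = head_mx^T.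
Proof. by apply/matrixP => i j; rewrite mul_flip_mx !mxE enum_rankK. Qed.

Lemma orientation_mx_involution : orientation_mx *m orientation_mx = 1%:M.
Proof.
rewrite mulmx_diag -diag_const_mx; congr diag_mx; apply/rowP => i.
by rewrite !mxE -expr2 sqrr_sign.
Qed.

Lemma orientation_arc_inv (a : arc e) : orientation (arc_inv a) = - orientation a.
Proof.
rewrite /orientation org_arc_inv ter_arc_inv.
have : org a != ter a.
  by apply/eqP => loop; have := valP a; rewrite -/(org a) -/(ter a) loop e_irr.
rewrite -(inj_eq enum_rank_inj) -(inj_eq val_inj) /=.
by case: ltngtP => //= _ _; rewrite ?expr1 ?expr0 ?opprK.
Qed.

(** This anticommutation makes the two eigenspaces of reversal exchangeable, and
    is the reason why both have dimension m. *)
Lemma orientation_flip_mx : orientation_mx *m flip_mx *m orientation_mx = - flip_mx.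
Proof.
apply/matrixP => i j; rewrite mul_mx_diag mxE mul_diag_mx !mxE is_invE.
case: eqP => [->|_]; last by rewrite mulr0 mul0r oppr0.
by rewrite orientation_arc_inv mulr1 mulrN -expr2 sqrr_sign.
Qed.

Lemma head_tail_mx : head_mx *m tail_mx = adjacency_mx C e.
Proof.
apply/matrixP => i j; rewrite !mxE.
set v := enum_val i; set u := enum_val j.
transitivity (\sum_(a : arc e) ((val a).2 == v)%:R * ((val a).1 == u)%:R : C).
  by rewrite -[RHS]sum_enum_val; apply: eq_bigr => k _; rewrite !mxE.
rewrite (sum_arc (fun p => (p.2 == v)%:R * (p.1 == u)%:R)) /= e_sym.
rewrite -(sum_delta u (fun x => (e x v)%:R)); apply: eq_bigr => x _.
rewrite -(sum_delta v (fun y => (e x y)%:R)) mulr_sumr; apply: eq_bigr => y _.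
by rewrite mulrC mulrAC mulrC.
Qed.

(** The product is the diagonal matrix of in-degrees. *)
Lemma head_trmx_head_mx (d : nat) :
  regular e d -> head_mx *m head_mx^T = d%:R%:M.
Proof.
move=> reg; apply/matrixP => i j; rewrite !mxE -(inj_eq enum_val_inj).
set v := enum_val i; set u := enum_val j.
transitivity (\sum_(a : arc e) ((val a).2 == v)%:R * ((val a).2 == u)%:R : C).
  by rewrite -[RHS]sum_enum_val; apply: eq_bigr => k _; rewrite !mxE.
rewrite (sum_arc (fun p => (p.2 == v)%:R * (p.2 == u)%:R)) /=.
transitivity (\sum_x (e v x)%:R * (v == u)%:R : C).
  apply: eq_bigr => x _; rewrite e_sym.
  rewrite -(sum_delta v (fun y => (e x y)%:R * (y == u)%:R)).
  by apply: eq_bigr => y _; rewrite mulrCA.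
by rewrite -mulr_suml sum_deg reg mulr_natr.
Qed.

(** For an arc f inverse to e, the origin of e is also the terminus of f, so that
    the first summand contributes 4/d^2 there; the coefficient of the flip is
    the difference with (2/d - 1)^2. *)
Lemma transition_mxE (d : nat) :
  (0 < d)%N -> regular e d ->
  transition_mx C e = (4%:R / d%:R ^+ 2) *: (tail_mx *m head_mx)
                      + ((d%:R - 4%:R) / d%:R) *: flip_mx.
Proof.
move=> d_gt0 reg; apply/matrixP => i j; rewrite !mxE /grover_entry reg.
set a := enum_val i; set b := enum_val j.
have -> : \sum_k tail_mx i k * head_mx k j = (ter b == org a)%:R.
  rewrite -(sum_delta (org a) (fun v => (ter b == v)%:R)) -[RHS]sum_enum_val.
  by apply: eq_bigr => k _; rewrite !mxE eq_sym.
have d_neq0 : d%:R != 0 :> C by rewrite pnatr_eq0 -lt0n.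
rewrite is_invE; case: eqP => [->|_].
  rewrite ter_arc_inv eqxx real_normK; last by rewrite rpredB ?rpred_div ?realn ?real1.
  by rewrite !mulr1; field.
case: (ter b == org a); rewrite ?mulr1 !mulr0 addr0.
  rewrite real_normK; last by rewrite rpred_div ?realn.
  by field.
by rewrite normr0 expr0n.
Qed.

Lemma card_arc_regular (d : nat) : regular e d -> #|arc e| = (#|T| * d)%N.
Proof.
move=> reg; apply/eqP; rewrite -(eqr_nat C) -sum1_card natr_sum.
rewrite (sum_arc (fun=> 1)) natrM mulr_natl -sumr_const; apply/eqP.
apply: eq_bigr => u _; rewrite -(reg u) -sum_deg.
by apply: eq_bigr => v _; rewrite mulr1.
Qed.

(** The map from arcs to edges is two-to-one, as there are no loops. *)
Lemma card_arc_edges : #|arc e| = (2 * #|edges e|)%N.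
Proof.
rewrite card_sig -[LHS]sum1_card.
rewrite (partition_big (fun p : T * T => [set p.1; p.2]) (mem (edges e))) /=; last first.
  by move=> p e_p; apply/imsetP; exists p.
rewrite mulnC -sum_nat_const; apply: eq_bigr => E /imsetP[[u v]].
rewrite inE /= => e_uv ->; rewrite sum1dep_card.
have neq_uv : u != v by apply: contraTneq e_uv => ->; rewrite e_irr.
suff -> : [set p | e p.1 p.2 && ([set p.1; p.2] == [set u; v])] = [set (u, v); (v, u)].
  by rewrite cards2 xpair_eqE (negbTE neq_uv).
apply/setP => -[x y]; rewrite !inE /= !xpair_eqE.
apply/idP/idP; last first.
  case/orP => /andP[/eqP-> /eqP->]; first by rewrite e_uv eqxx.
  by rewrite e_sym e_uv setUC eqxx.
case/andP => e_xy /eqP xy_uv.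
have neq_xy : x != y by apply: contraTneq e_xy => ->; rewrite e_irr.
have : x \in [set u; v] by rewrite -xy_uv set21.
have : y \in [set u; v] by rewrite -xy_uv set22.
rewrite !inE => /orP[]/eqP y_eq /orP[]/eqP x_eq; subst x y; rewrite ?eqxx ?orbT //.
  by rewrite eqxx in neq_xy.
by rewrite eqxx in neq_xy.
Qed.
End Arcs.

(** * The spectrum of the transition matrix *)

Theorem corollary3 (C : numClosedFieldType) (T : finType) (e : rel T)
    (d n m : nat) :
  symmetric e -> irreflexive e -> connected_graph e ->
  regular e d -> (2 <= d)%N ->
  n = #|T| -> m = #|edges e| ->
  let S : seq C :=
    [seq (2%:R * l + s * sqrtC (4%:R * l ^+ 2 - d%:R ^+ 3 * (4%:R - d%:R)))
           / d%:R ^+ 2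
    | l <- eigenvalues (adjacency_mx C e), s <- [:: 1; -1]] in
  [/\ (n <= m)%N,
      size S = (2 * n)%N
    & perm_eq (eigenvalues (transition_mx C e))
        (S ++ nseq (m - n) ((4%:R - d%:R) / d%:R)
           ++ nseq (m - n) (- ((4%:R - d%:R) / d%:R)))].
Proof.
move=> e_sym e_irr _ reg d_ge2 -> mE S.
have d_gt0 : (0 < d)%N by apply: leq_trans d_ge2.
have card_arc : (#|T| * d = 2 * m)%N.
  by rewrite mE -card_arc_edges // (card_arc_regular C reg).
have le_nm : (#|T| <= m)%N.
  by rewrite -(leq_pmul2l (ltn0Sn 1)) -card_arc mulnC leq_mul2l d_ge2 orbT.
split=> //; first by rewrite size_allpairs size_eigenvalues /= mulnC.
apply: prod_XsubC_eq; rewrite -eigenvaluesP !big_cat /= !big_nseq.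
have d_neq0 : d%:R != 0 :> C by rewrite pnatr_eq0 -lt0n.
set b : C := (d%:R - 4%:R) / d%:R; set a : C := 4%:R / d%:R ^+ 2.
pose q : {poly C} := 'X^2 - (b ^+ 2)%:P.
have JJ := flip_mx_involution C e_sym.
pose N := 'X%:M - map_mx polyC (b *: flip_mx C e).
pose N' := 'X%:M + map_mx polyC (b *: flip_mx C e).
pose K := map_mx polyC (a *: tail_mx C e).
pose L := map_mx polyC (head_mx C e).
have NN' : N *m N' = q%:M by apply: mul_char_poly_mx_involution.
have detN : \det N = q ^+ m.
  apply: (char_poly_involution _ _ JJ
    (orientation_mx_involution C e) (orientation_flip_mx C e_sym e_irr)).
  by rewrite mE -card_arc_edges.
have LNK : L *m N' *m K
    = (a%:P * 'X) *: map_mx polyC (adjacency_mx C e) + ((a * b * d%:R)%:P)%:M.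
  rewrite mulmxDr mulmxDl mul_mx_scalar -scalemxAl -!map_mxM.
  rewrite -scalemxAr head_tail_mx //.
  rewrite -!scalemxAr -!scalemxAl -mulmxA flip_tail_mx //.
  rewrite (head_trmx_head_mx C e_sym reg).
  rewrite !map_mxZ map_scalar_mx /= scalerA [a%:P * _]mulrC; congr (_ + _).
  by rewrite !scale_scalar_mx -!polyCM mulrA.
have charP : char_poly (transition_mx C e) = \det (N - K *m L).
  rewrite (transition_mxE C e_sym d_gt0 reg) /char_poly /char_poly_mx.
  congr determinant; rewrite map_mxD -map_mxM scalemxAl opprD addrA.
  by rewrite /N addrAC.
have q_neq0 : q != 0 by rewrite monic_neq0 // monicXnsubC.
have := det_sub_mulmx K L NN'.
have q_split : q ^+ m = q ^+ (m - #|T|) * q ^+ #|T| by rewrite -exprD subnK.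
rewrite -charP LNK detN q_split mulrAC.
have /mulIf cancel_q := expf_neq0 #|T| q_neq0; move/cancel_q => ->.
rewrite opprD addrA addrAC -raddfB.
rewrite (det_scalar_sub_scale _ _ (eigenvaluesP (adjacency_mx C e))) mulrC.
congr (_ * _); last first.
  (* q splits as ('X + b) ('X - b), and -b is (4 - d) / d. *)
  rewrite !iter_mulr_1 -exprMn; congr (_ ^+ _).
  have -> : (4%:R - d%:R) / d%:R = - b by rewrite -mulNr opprB.
  by rewrite mul_XsubC opprK addNr mul0r subr0 mulNr polyCN -expr2.
rewrite /S big_allpairs_dep; apply: eq_bigr => l _.
rewrite prod_XsubC_quadratic // -/a -/b /q.
have bE : b ^+ 2 + a * b * d%:R = b by rewrite /a /b; field.
by rewrite -[in RHS]bE (polyCD (b ^+ 2)) (polyCM a l); ring.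
Qed.
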